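(* Let $H=([r],E)$ be an undirected graph on $r$ vertices with edge set $E$, and let $m=|E|$. Let $\mathcal{C}_r$ be the collection of all Hamilton cycles in $H$, each regarded as an $r$-element subset of $E$. Any two distinct Hamilton cycles differ in at least four edges, so that $|C\oplus C'|>2$ for all distinct $C,C'\in\mathcal{C}_r$, and hence $\mathcal{C}_r$ defines a sparse paving matroid $(E,\mathcal{B})$ of rank $r$ on $E$, namely the one whose circuits of size $r$ are the members of $\mathcal{C}_r$ and whose set of bases $\mathcal{B}$ consists of all $r$-element subsets of $E$ not in $\mathcal{C}_r$. Furthermore, the number of Hamilton cycles in $H$ is equal to $|\mathcal{C}_r|=\binom{m}{r}-|\mathcal{B}|$.
   Context: Here $\oplus$ denotes symmetric difference. A matroid $(E,\mathcal{B})$ consists of a finite ground set $E$ and a collection $\mathcal{B}\subseteq 2^E$ of bases such that all bases have the same size $r$ (the rank), and for every pair of bases $X,Y\in\mathcal{B}$ and every $e\in X$ there exists $f\in Y$ such that $(X\setminus\{e\})\cup\{f\}\in\mathcal{B}$. A subset of $E$ is independent if it is a subset of some basis, and dependent otherwise; a circuit is a minimal (with respect to inclusion) dependent set. A matroid of rank $r$ is paving if all $(r-1)$-element subsets of $E$ are independent; then every $r$-element subset of $E$ is either a basis or a circuit, so the matroid is defined by its set of circuits with $r$ elements. A paving matroid of rank $r$ is sparse if $|C\oplus C'|>2$ for all distinct circuits $C,C'$ of size $r$.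
   Formalization: The sparse paving matroid claim is stated for the case that at least one r-element subset of E is not a Hamilton cycle (the set of bases is nonempty); otherwise, e.g. when H is itself an r-cycle or m < r, no such matroid of rank r exists. *)

(* Defs.v *)
From mathcomp Require Import all_boot.

Set Implicit Arguments.
Unset Strict Implicit.
Unset Printing Implicit Defensive.

Section Matroids.
Variable T : finType.
Implicit Types (E X C D : {set T}) (B : {set {set T}}) (r : nat).

Definition symdiff X D : {set T} := (X :\: D) :|: (D :\: X).

(* The ground set is a subset E of an ambient finite type.  The rank is the
   common size of the bases, so a matroid is required to have a basis. *)
Definition matroid E B r : Prop :=
  [/\ B != set0,
      forall X, X \in B -> X \subset E,
      forall X, X \in B -> #|X| = r &
      forall X Y e, X \in B -> Y \in B -> e \in X ->
        exists2 f, f \in Y & f |: (X :\ e) \in B].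

Definition independent B X : bool := [exists Y in B, X \subset Y].

Definition dependent E B X : bool := (X \subset E) && ~~ independent B X.

Definition circuit E B C : bool := minset (dependent E B) C.

Definition circuits_of_size E B r : {set {set T}} :=
  [set C | circuit E B C & #|C| == r].

(* "#|S|.+1 = r" instead of "#|S| = r - 1": truncated subtraction would give a
   spurious condition when r = 0. *)
Definition paving_matroid E B r : Prop :=
  matroid E B r /\
  forall S : {set T}, S \subset E -> #|S|.+1 = r -> independent B S.

Definition sparse_paving_matroid E B r : Prop :=
  paving_matroid E B r /\
  forall C D, C \in circuits_of_size E B r -> D \in circuits_of_size E B r ->
    C != D -> 2 < #|symdiff C D|.

End Matroids.

Section HamiltonCycles.
Variable V : finType.
Implicit Types (E F : {set {set V}}).

(* Edges are unordered pairs of distinct vertices: no loops, no parallel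
   edges. *)
Definition simple_edges E : Prop := forall e, e \in E -> #|e| = 2.

(* A graph is given as a pair (vertex set, edge set).  It is a cycle if its
   vertices can be listed without repetition as x_0, ..., x_(n-1), n >= 3, so
   that its edges are exactly the {x_i, x_(i+1)}, indices modulo n. *)
Definition cycle_graph (G : {set V} * {set {set V}}) : bool :=
  (2 < #|G.1|) &&
  [exists s : #|G.1|.-tuple V,
    [&& uniq s, G.1 == [set x in s]
      & G.2 == [set [set x; next s x] | x in s]]].

(* The subgraphs of (V, E) that are cycles through all the vertices. *)
Definition hamilton_cycles E : {set {set V} * {set {set V}}} :=
  [set G : {set V} * {set {set V}} |
     [&& G.1 == setT, G.2 \subset E & cycle_graph G]].

Definition hamilton_edge_sets E : {set {set {set V}}} :=
  [set G.2 | G in hamilton_cycles E].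

Definition non_hamilton_sets E (r : nat) : {set {set {set V}}} :=
  [set X : {set {set V}} |
     [&& X \subset E, #|X| == r & X \notin hamilton_edge_sets E]].

End HamiltonCycles.

(* Main.v *)
Require Import Defs.
From mathcomp Require Import all_boot.

Set Implicit Arguments.
Unset Strict Implicit.
Unset Printing Implicit Defensive.

(** Every vertex has degree 2 in a Hamilton cycle.  If two Hamilton cycles
    differed by exchanging one edge e for one edge f, comparing degrees at each
    vertex would force e and f to have the same endpoints.  As all Hamilton
    cycles have r edges, distinct ones differ in at least four edges.
    For the basis exchange, let S be an (r-1)-subset of E and Y a basis.  If
    Y \ S has two elements f and g, then S + f and S + g differ in two elements
    only, so one of them is a basis; otherwise S lies in Y and Y = S + f. *)

Lemma card_symdiff (T : finType) (X D : {set T}) :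
  #|symdiff X D| = #|X :\: D| + #|D :\: X|.
Proof.
rewrite /symdiff cardsU (_ : _ :&: _ = set0) ?cards0 ?subn0 //.
by apply/setP=> x; rewrite !inE; case: (x \in X); case: (x \in D).
Qed.

Lemma symdiff_add1 (T : finType) (S : {set T}) f g :
  #|symdiff (f |: S) (g |: S)| <= 2.
Proof.
apply: leq_trans (_ : #|[set f; g]| <= 2); last by rewrite cards2; case: (_ != _).
apply/subset_leq_card/subsetP=> x; rewrite !inE.
by case: (x \in S); case: (x == f); case: (x == g).
Qed.

Lemma eq_card_setD (T : finType) (X D : {set T}) :
  #|X| = #|D| -> #|X :\: D| = #|D :\: X|.
Proof.
by move=> XD; apply/eqP; rewrite -(eqn_add2l #|X :&: D|) cardsID setIC cardsID XD.
Qed.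

(** Used with [I] the set of edges at a vertex: it compares degrees in two edge sets that differ in
    a single edge on each side. *)
Lemma card_setI_setD1 (T : finType) (A D I : {set T}) x :
  A :\: D = [set x] -> #|A :&: I| = #|A :&: D :&: I| + (x \in I).
Proof.
move=> ADx; rewrite -(cardsID D) setIAC -setIDAC ADx; congr (_ + _).
have [xI | xI] := boolP (x \in I); first by rewrite (setIidPl _) ?cards1 ?sub1set.
by apply/eqP; rewrite cards_eq0 setI_eq0 disjoints1.
Qed.

Section SparsePaving.
Variables (T : finType) (E : {set T}) (r : nat) (F B : {set {set T}}).
Hypothesis F_sparse :
  forall C D, C \in F -> D \in F -> C != D -> 2 < #|symdiff C D|.
Hypothesis inB : forall X, (X \in B) = [&& X \subset E, #|X| == r & X \notin F].

(** Serves twice: with [S] a basis minus an element it is basis exchange, and for arbitrary [S] it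
    gives the paving condition, since [S] then lies in the basis [f |: S]. *)
Lemma sparse_augment (S Y : {set T}) :
  S \subset E -> #|S|.+1 = r -> Y \in B -> exists2 f, f \in Y & f |: S \in B.
Proof.
move=> SE Sr YB; have := YB; rewrite inB => /and3P[YE /eqP Yr YF].
have hD f : f \in Y :\: S -> (f |: S \in B) = (f |: S \notin F).
  rewrite inE => /andP[fS fY]; rewrite inB cardsU1 fS add1n Sr eqxx.
  by rewrite subUset sub1set (subsetP YE) ?SE.
have : 0 < #|Y :\: S| by rewrite cardsD subn_gt0 Yr -Sr ltnS subset_leq_card ?subsetIr.
case/card_gt0P=> f fD; have := fD; rewrite inE => /andP[fS fY].
case: (boolP (f |: S \in B)) => [fB | ]; first by exists f.
rewrite hD // negbK => fF.
(* If [f] is the only element of [Y] outside [S], then [Y] equals [f |: S], a member of [F], which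
   contradicts that [Y] is a basis. *)
have [D1 | ] := posnP #|Y :\: S :\ f|.
  have YfS : Y \subset f |: S.
    move/eqP: D1; rewrite cards_eq0 setD_eq0 => /subsetP sD.
    apply/subsetP=> y yY; rewrite !inE; case: (boolP (y \in S)) => [|yS].
      by rewrite orbT.
    by have := sD y; rewrite !inE yS yY => /(_ isT) ->.
  have /eqP YE' : Y == f |: S by rewrite eqEcard YfS cardsU1 fS add1n Sr Yr /=.
  by rewrite YE' fF in YF.
case/card_gt0P=> g; rewrite in_setD1 => /andP[gf gD].
have := gD; rewrite inE => /andP[gS gY]; exists g => //.
rewrite hD //; apply/negP=> gF.
have neq : f |: S != g |: S.
  apply/eqP=> /setP/(_ g); rewrite !inE eqxx (negbTE gf) /=.
  by rewrite (negbTE gS).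
by have := F_sparse fF gF neq; rewrite ltnNge symdiff_add1.
Qed.

Hypothesis B_neq0 : B != set0.

Lemma sparse_matroid : matroid E B r.
Proof.
split=> // [X | X | X Y e XB YB eX]; rewrite ?inB.
- by case/and3P.
- by case/and3P=> _ /eqP.
- have := XB; rewrite inB => /and3P[XE /eqP Xr _].
  apply: sparse_augment => //; last by rewrite -Xr (cardsD1 e X) eX.
  by rewrite (subset_trans (subsetDl _ _)).
Qed.

Lemma sparse_paving : paving_matroid E B r.
Proof.
split=> [|S SE Sr]; first exact: sparse_matroid.
case/set0Pn: B_neq0 => Y YB; have [f fY fB] := sparse_augment SE Sr YB.
by apply/existsP; exists (f |: S); rewrite fB subsetUr.
Qed.

End SparsePaving.

(** A set of size [r] inside a basis equals that basis, so a non-basis of size [r] is dependent. It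
    is minimal because a proper subset misses some [e] and lies in [X :\ e], which is independent by
    paving. *)
Lemma paving_circuits (T : finType) (E : {set T}) r (B : {set {set T}}) X :
  paving_matroid E B r ->
  (X \in circuits_of_size E B r) = [&& X \subset E, #|X| == r & X \notin B].
Proof.
move=> [[_ _ Br _] Bp]; rewrite inE /circuit.
apply/andP/and3P=> [[/minsetP[/andP[XE Xd] _] Xr] | [XE Xr XB]]; split=> //.
  by apply: contra Xd => XB; apply/existsP; exists X; rewrite XB subxx.
apply/minsetP; split.
  rewrite /dependent XE; apply/existsP=> -[Y /andP[YB XY]].
  have /eqP XY' : X == Y by rewrite eqEcard XY (Br Y) // (eqP Xr) leqnn.
  by rewrite XY' YB in XB.
move=> D /andP[DE Dd] DX; apply/eqP; rewrite eqEsubset DX /=.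
apply: contraR Dd => /subsetPn[e eX eD].
have /existsP[Y /andP[YB XY]] : independent B (X :\ e).
  apply: Bp; first exact: subset_trans (subsetDl _ _) XE.
  by rewrite -(eqP Xr) (cardsD1 e X) eX.
apply/existsP; exists Y; rewrite YB; apply: subset_trans XY.
by rewrite subsetD1 DX.
Qed.

Section CycleEdges.
Variables (V : finType) (s : seq V).
Hypotheses (s_uniq : uniq s) (s_size : 2 < size s).

Lemma next_neq x : x \in s -> next s x != x.
Proof.
(* Rotating the cycle to start at [x] leaves [next] unchanged and makes it computable. *)
case/rot_to=> i p def_s.
rewrite -(next_rot i s_uniq) def_s.
have := s_uniq; rewrite -(rot_uniq i) def_s.
have := s_size; rewrite -(size_rot i) def_s.
case: p {def_s} => // y p _; rewrite /= eqxx inE negb_or.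
by case/andP=> /andP[xy _] _; rewrite eq_sym.
Qed.

(** This is where length at least 3 matters: on two vertices [next] is an involution. *)
Lemma next_next_neq x : x \in s -> next s (next s x) != x.
Proof.
case/rot_to=> i p def_s.
rewrite -!(next_rot i s_uniq) def_s.
have := s_uniq; rewrite -(rot_uniq i) def_s.
have := s_size; rewrite -(size_rot i) def_s.
case: p {def_s} => [//|y [//|z p]] _ /=; rewrite eqxx !inE !negb_or.
case/andP=> /and3P[xy xz _] _.
by rewrite eqxx [y == x]eq_sym (negbTE xy) eq_sym.
Qed.

(** If distinct [x] and [y] gave the same edge, then [x] would be [next s y], and [next s x] would
    have to be [y] or [x] itself. *)
Lemma cycle_edge_inj : {in s &, injective (fun x => [set x; next s x])}.
Proof.
move=> x y xs ys eq_e; apply/eqP/negPn/negP=> xy.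
have := set21 x (next s x); rewrite eq_e !inE (negbTE xy) /= => /eqP xny.
have := set22 x (next s x); rewrite eq_e !inE xny.
by rewrite (negbTE (next_next_neq ys)) (negbTE (next_neq _)) // mem_next.
Qed.

Lemma card_cycle_edges : #|[set [set x; next s x] | x in s]| = size s.
Proof. by rewrite card_in_imset; [apply/card_uniqP | exact: cycle_edge_inj]. Qed.

(** The edges at [v] are the one leaving [v] and the one leaving its predecessor; they differ by
    injectivity. *)
Lemma cycle_degree v : v \in s ->
  #|[set [set x; next s x] | x in s] :&: [set e : {set V} | v \in e]| = 2.
Proof.
move=> vs.
have -> : [set [set x; next s x] | x in s] :&: [set e : {set V} | v \in e]
       = [set [set x; next s x] | x in [set v; prev s v]].
  apply/setP=> e; rewrite !inE; apply/andP/imsetP.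
    case=> /imsetP[x xs ->]; rewrite !inE => /orP[] /eqP ->.
      by exists x; rewrite // !inE eqxx.
    by exists x; rewrite // !inE prev_next // eqxx orbT.
  case=> x; rewrite !inE => /orP[] /eqP-> ->.
    by rewrite !inE eqxx; split=> //; apply: imset_f.
  rewrite !inE next_prev // eqxx orbT; split=> //.
  by apply/imsetP; exists (prev s v); rewrite ?mem_prev // next_prev.
rewrite card_in_imset.
  rewrite cards2 -{1}(next_prev s_uniq v).
  by rewrite next_neq // mem_prev.
by move=> x y; rewrite !inE => /orP[] /eqP-> /orP[] /eqP->;
  apply: cycle_edge_inj; rewrite ?mem_prev.
Qed.

End CycleEdges.

Lemma hamilton_edge_setP (V : finType) (E C : {set {set V}}) :
  C \in hamilton_edge_sets E ->
  exists s : seq V, [/\ uniq s, 2 < size s, s =i V, size s = #|V| &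
    C \subset E /\ C = [set [set x; next s x] | x in s]].
Proof.
case/imsetP=> -[W D]; rewrite inE /= => /and3P[/eqP-> DE /andP[V2]].
case/existsP=> s /and3P[su /eqP sV /eqP DS] ->; exists s.
have ss : size s = #|V| by rewrite size_tuple cardsT.
split=> //; first by rewrite size_tuple.
by move=> x; have /setP/(_ x) := sV; rewrite !inE.
Qed.

Lemma card_hamilton_edge_set (V : finType) (E C : {set {set V}}) :
  C \in hamilton_edge_sets E -> C \subset E /\ #|C| = #|V|.
Proof.
case/hamilton_edge_setP=> s [su s2 _ <- [CE DC]]; split=> //.
by rewrite DC card_cycle_edges.
Qed.

Lemma hamilton_degree (V : finType) (E C : {set {set V}}) v :
  C \in hamilton_edge_sets E -> #|C :&: [set e : {set V} | v \in e]| = 2.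
Proof.
by case/hamilton_edge_setP=> s [su s2 sV _ [_ ->]]; rewrite cycle_degree ?sV.
Qed.

Lemma hamilton_symdiff (V : finType) (E C D : {set {set V}}) :
  C \in hamilton_edge_sets E -> D \in hamilton_edge_sets E -> C != D ->
  4 <= #|symdiff C D|.
Proof.
move=> CH DH CD.
have [[_ Cr] [_ Dr]] := (card_hamilton_edge_set CH, card_hamilton_edge_set DH).
have CDr := eq_card_setD (etrans Cr (esym Dr)).
(* Both differences have the same size, so it suffices that [C :\: D] has at least two elements. *)
rewrite card_symdiff -CDr addnn (leq_double 2).
rewrite leqNgt ltnS; apply/negP=> le1; have [d0 | d_gt0] := posnP #|C :\: D|.
  move/eqP: d0; rewrite cards_eq0 setD_eq0 => CsD.
  by case/negP: CD; rewrite eqEcard CsD Cr Dr leqnn.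
have d1 : #|C :\: D| == 1 by rewrite eqn_leq le1.
have /cards1P[e CDe] := d1; have /cards1P[f DCf] : #|D :\: C| == 1 by rewrite -CDr.
have eC : e \in C :\: D by rewrite CDe set11.
have fD : f \in D :\: C by rewrite DCf set11.
suff ef : e = f by move: eC fD; rewrite ef !inE => /andP[/negbTE->]; rewrite andbF.
apply/setP=> v.
(* Both degrees at [v] are 2; cancelling the edges common to [C] and [D] leaves [v \in e] equal to
   [v \in f]. *)
have := card_setI_setD1 [set e0 : {set V} | v \in e0] CDe.
rewrite (hamilton_degree v CH) -(hamilton_degree v DH) (card_setI_setD1 _ DCf).
by rewrite [D :&: C]setIC !inE => /addnI; do 2!case: (v \in _).
Qed.

(** All Hamilton cycles share the full vertex set, so the edge set determines the cycle. *)
Lemma card_hamilton_cycles (V : finType) (E : {set {set V}}) :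
  #|hamilton_cycles E| = #|hamilton_edge_sets E|.
Proof.
rewrite card_in_imset // => -[W D] [W' D']; rewrite !inE /=.
by move=> /and3P[/eqP-> _ _] /and3P[/eqP-> _ _] ->.
Qed.

Theorem mainTheorem3 (r : nat) (E : {set {set 'I_r}}) (hE : simple_edges E) :
  let m := #|E| in
  let Cr := hamilton_edge_sets E in
  let B := non_hamilton_sets E r in
  [/\ forall C, C \in Cr -> C \subset E /\ #|C| = r,
      forall C C', C \in Cr -> C' \in Cr -> C != C' ->
        4 <= #|symdiff C C'| /\ 2 < #|symdiff C C'|,
      B != set0 ->
        [/\ sparse_paving_matroid E B r,
            circuits_of_size E B r = Cr
          & forall B' : {set {set {set 'I_r}}}, paving_matroid E B' r ->
              circuits_of_size E B' r = Cr -> B' = B],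
      #|hamilton_cycles E| = #|Cr|
    & #|Cr| = 'C(m, r) - #|B|].
Proof.
move=> m Cr B.
have Cr_sub C : C \in Cr -> C \subset E /\ #|C| = r.
  by move/card_hamilton_edge_set; rewrite card_ord.
have Cr_sparse C D : C \in Cr -> D \in Cr -> C != D -> 2 < #|symdiff C D|.
  by move=> CH DH CD; apply: ltnW; apply: hamilton_symdiff CH DH CD.
have inB X : (X \in B) = [&& X \subset E, #|X| == r & X \notin Cr] by rewrite inE.
(* In a paving matroid the circuits of size [r] determine the bases, which yields uniqueness. *)
have circ_inv (B' : {set {set {set 'I_r}}}) X :
    paving_matroid E B' r -> circuits_of_size E B' r = Cr ->
    (X \in B') = [&& X \subset E, #|X| == r & X \notin Cr].
  move=> pB' <-; rewrite paving_circuits //.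
  case: (pB') => -[_ B'E B'r _] _; apply/idP/and3P=> [XB | [-> -> /[!negbK]] //].
  by rewrite B'E // B'r ?eqxx // XB.
split=> // [C C' CH C'H CC' | B0 | | ].
- by split; [apply: hamilton_symdiff CH C'H CC' | apply: Cr_sparse].
- have pB := sparse_paving Cr_sparse inB B0.
  have circB : circuits_of_size E B r = Cr.
    apply/setP=> X; rewrite paving_circuits // inB.
    have [/Cr_sub[-> ->] | ] := boolP (X \in Cr); first by rewrite eqxx.
    by case: (X \subset E); case: (#|X| == r).
  split=> // [|B' pB' circB']; first by split=> // C D; rewrite circB; apply: Cr_sparse.
  by apply/setP=> X; rewrite inB (circ_inv B').
- exact: card_hamilton_cycles.
(* The [r]-subsets of [E] split into [Cr] and [B], so the subtraction is not truncated. *)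
- rewrite -cards_draws -(cardsID Cr [set X | _ & _]) (_ : _ :&: Cr = Cr); last first.
    by apply/setIidPr/subsetP=> C /Cr_sub[CE Cr']; rewrite inE CE Cr' eqxx.
  rewrite (_ : _ :\: Cr = B) ?addnK //; apply/setP=> X.
  by rewrite inB !inE andbC andbA.
Qed.
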